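(* Let $\Gamma$ be a weighted directed multigraph, possibly with loops, with vertex set $\{1,\dots,n\}$ and positive arc weights. Let $r_{ij}$ be the total weight of all routes from $i$ to $j$ in $\Gamma$, and suppose that the matrix $R=(r_{ij})_{n\times n}$ is finite. Then $R$ determines a transitional measure for $\Gamma$.
   Context: A route (walk) from $v_0$ to $v_k$ is any alternating sequence $v_0,a_1,v_1,\dots,a_k,v_k$ with each $a_i$ an arc (possibly a loop) from $v_{i-1}$ to $v_i$; its weight is the product of the weights of its $k$ arcs counted with repetition; for each vertex $v_0$ the route $v_0$ has length $0$ and weight $1$. The weight of a (possibly infinite) set of routes is the sum of their weights. A directed path is a route in which all vertices are distinct (the route $v_0$ of length $0$ is the path from $v_0$ to $v_0$). $S=(s_{ij})$ satisfies the transition inequality if $s_{ij}s_{jk}\le s_{ik}s_{jj}$ for all $i,j,k$; it satisfies the graph bottleneck identity w.r.t. $\Gamma$ if for all $i,j,k$: $s_{ij}s_{jk}=s_{ik}s_{jj}$ holds if and only if every directed path in $\Gamma$ from $i$ to $k$ contains $j$. $S$ determines a transitional measure for $\Gamma$ if it satisfies both. *)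

(* Defs.v *)
From HB Require Import structures.
From mathcomp Require Import all_boot all_order all_algebra.
From mathcomp Require Import all_classical all_reals all_analysis.

Set Implicit Arguments.
Unset Strict Implicit.
Unset Printing Implicit Defensive.

Import Order.TTheory GRing.Theory Num.Theory.

Local Open Scope classical_set_scope.
Local Open Scope ring_scope.

(* Parallel arcs are distinct elements of [arc] with the same endpoints; loops
   are arcs whose source and target coincide. *)
Record wdmultigraph (R : realType) (n : nat) := WDMultigraph {
  arc : finType;
  arc_src : arc -> 'I_n;
  arc_tgt : arc -> 'I_n;
  arc_weight : arc -> R;
  arc_weight_gt0 : forall a, 0 < arc_weight a
}.

Section Routes.
Variables (R : realType) (n : nat) (G : wdmultigraph R n).

(* The alternating sequence v_0, a_1, v_1, ..., a_k, v_k is encoded by its first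
   vertex v_0, passed separately, and the list of steps
   [:: (a_1, v_1); ...; (a_k, v_k)]. *)
Definition steps := seq (arc G * 'I_n).

Fixpoint is_route (i j : 'I_n) (p : steps) : bool :=
  if p is (a, v) :: p' then
    [&& arc_src a == i, arc_tgt a == v & is_route v j p']
  else i == j.

Definition route_vertices (i : 'I_n) (p : steps) : seq 'I_n := i :: unzip2 p.

Definition is_dipath (i j : 'I_n) (p : steps) : bool :=
  is_route i j p && uniq (route_vertices i p).

Definition route_weight (p : steps) : R := \prod_(s <- p) arc_weight s.1.

(* Routes have positive weight, so this sum over a possibly infinite set is the
   supremum of its finite partial sums, possibly +oo. *)
Definition routes_weight (i j : 'I_n) : \bar R :=
  (\esum_(p in [set p : steps | is_route i j p]) (route_weight p)%:E)%E.

(* The entries are meaningful only when every [routes_weight i j] is finite: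
   [fine] sends +oo to 0. *)
Definition routes_matrix : 'M[R]_n :=
  \matrix_(i, j) fine (routes_weight i j).

End Routes.

Definition transition_inequality (R : realType) (n : nat) (S : 'M[R]_n) : Prop :=
  forall i j k : 'I_n, S i j * S j k <= S i k * S j j.

Definition graph_bottleneck_identity (R : realType) (n : nat)
    (G : wdmultigraph R n) (S : 'M[R]_n) : Prop :=
  forall i j k : 'I_n,
    S i j * S j k = S i k * S j j <->
    (forall p : steps G, is_dipath i k p -> j \in route_vertices i p).

Definition transitional_measure (R : realType) (n : nat)
    (G : wdmultigraph R n) (S : 'M[R]_n) : Prop :=
  transition_inequality S /\ graph_bottleneck_identity G S.

(* Main.v *)
(** Split the routes from [i] to [k] into those that visit [j] and those that
    avoid it.  Cutting a route of the first kind at its first visit to [j] gives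
    r_ik = f_ij r_jk + b_ijk, where f_ij is the weight of the routes from [i]
    that reach [j] only at their end and b_ijk that of the routes avoiding [j].
    For k = j the last term vanishes, so r_ij = f_ij r_jj and therefore
    r_ik r_jj - r_ij r_jk = b_ijk r_jj with r_jj >= 1.  This is nonnegative, and
    it is zero exactly when no route, hence no path, from [i] to [k] avoids
    [j]. *)
Require Import Defs.
From HB Require Import structures.
From mathcomp Require Import all_boot all_order all_algebra.
From mathcomp Require Import all_classical all_reals all_analysis.
From mathcomp Require Import ring.

Set Implicit Arguments.
Unset Strict Implicit.
Unset Printing Implicit Defensive.

Import Order.TTheory GRing.Theory Num.Theory.

Local Open Scope classical_set_scope.
Local Open Scope ring_scope.

Section ESum.
Variables (R : realType) (T : choiceType).
Implicit Types (A B : set T) (a : T -> \bar R).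

(** An [\esum] is a supremum of finite partial sums, and scaling by a nonnegative real commutes with
    a nonempty supremum. *)
Lemma ge0_esumZl A a (c : R) : (forall x, A x -> (0 <= a x)%E) -> 0 <= c ->
  (\esum_(x in A) (c%:E * a x) = c%:E * \esum_(x in A) a x)%E.
Proof.
move=> a_ge0 c_ge0; rewrite /esum -ereal_supZl //; last first.
  apply/set0P; exists (\sum_(x \in set0) a x)%E.
  by exists set0 => //; apply: fsets_set0.
rewrite image_comp; congr ereal_sup; apply: eq_imagel => X [_ XA] /=.
(* The absolute value makes the summand nonnegative everywhere, not only on [A], as [ge0_mule_fsumr]
   requires. *)
rewrite (eq_fsbigr (fun x => (c%:E * `|a x|)%E)); last first.
  by move=> x; rewrite inE => /XA Ax; rewrite gee0_abs // a_ge0.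
rewrite -ge0_mule_fsumr; last by [].
by congr *%E; apply: eq_fsbigr => x; rewrite inE => /XA Ax;
  rewrite gee0_abs // a_ge0.
Qed.

Lemma le_esum_subset A B a : A `<=` B -> (forall x, B x -> (0 <= a x)%E) ->
  (\esum_(x in A) a x <= \esum_(x in B) a x)%E.
Proof.
move=> AB a_ge0; rewrite [leRHS](esumID A) // setIC ((setIidPl _ _).2 AB) leeDl //.
by apply: esum_ge0 => x [/a_ge0].
Qed.

Lemma le_term_esum A a x : A x -> (forall y, A y -> (0 <= a y)%E) ->
  (a x <= \esum_(y in A) a y)%E.
Proof.
move=> Ax a_ge0; rewrite -[leLHS](esum_set1 (a := a)) ?a_ge0 //.
by apply: le_esum_subset => // y ->.
Qed.

End ESum.

Section FirstPassage.
Variables (R : realType) (n : nat) (G : wdmultigraph R n).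
Implicit Types (i j k : 'I_n) (p q : steps G).

Lemma route_catE i j k p q : is_route i j p ->
  is_route i k (p ++ q) = is_route j k q.
Proof.
elim: p i => [|[a v] p IHp] i /=; first by move/eqP->.
by case/and3P=> -> -> /IHp.
Qed.

(** The junction [j] both ends [p] and starts [q]; [belast] keeps it from being listed twice. *)
Lemma route_vertices_cat i j p q : is_route i j p ->
  route_vertices i (p ++ q) = belast i (unzip2 p) ++ route_vertices j q.
Proof.
rewrite /route_vertices; elim: p i => [|[a v] p IHp] i /=; first by move/eqP->.
by case/and3P=> _ _ /IHp ->.
Qed.

Lemma route_end_mem i j p : is_route i j p -> j \in route_vertices i p.
Proof.
by move=> ijp; rewrite -[p]cats0 (route_vertices_cat _ ijp) mem_cat mem_head orbT.
Qed.

Lemma route_weight_cat p q :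
  route_weight (p ++ q) = route_weight p * route_weight q.
Proof. exact: big_cat. Qed.

Lemma route_weight_gt0 p : 0 < route_weight p.
Proof. by apply: prodr_gt0 => s _; apply: arc_weight_gt0. Qed.

(** [belast] drops the final vertex, so [j] is visited once, at the very end. *)
Definition first_passage i j p :=
  is_route i j p && (j \notin belast i (unzip2 p)).

Lemma first_passage_split i j k p :
  is_route i k p -> j \in route_vertices i p ->
  exists p1 p2, [/\ p = p1 ++ p2, first_passage i j p1 & is_route j k p2].
Proof.
elim: p i => [|[a v] p IHp] i ikp; rewrite inE; case: eqVneq => [ji _|ji /=].
- by exists [::], [::]; rewrite ji /first_passage /= eqxx.
- by [].
- by exists [::], ((a, v) :: p); rewrite ji /first_passage /= eqxx.
move=> j_in; case/and3P: ikp => ai av vkp.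
have [p1 [p2 [-> /andP[vjp1 p1j] jkp2]]] := IHp v vkp j_in.
exists ((a, v) :: p1), p2; split=> //.
by rewrite /first_passage /= ai av vjp1 inE negb_or ji.
Qed.

(** Otherwise one of [p], [q] would be a proper prefix of the other, and the longer one would meet
    [j] before its end. This makes the cut at the first visit unique. *)
Lemma first_passage_uniq i j p q p' q' :
  first_passage i j p -> first_passage i j q -> p ++ p' = q ++ q' -> p = q.
Proof.
rewrite /first_passage.
elim: p i q => [|[a v] p IHp] i [|[b w] q] //=.
- by case/andP=> /eqP-> _; rewrite mem_head andbF.
- by move=> /[swap] /andP[/eqP-> _]; rewrite mem_head andbF.
rewrite !inE !negb_or => /andP[/and3P[_ _ vjp] /andP[_ p_j]].
move=> /andP[/and3P[_ _ wjq] /andP[_ q_j]] [ab vw eq_pq]; subst b w.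
by rewrite (IHp v q) // ?vjp ?wjq.
Qed.

(** Loop erasure. The inclusion of vertices ensures that a route avoiding [j] yields a path avoiding
    [j]. *)
Lemma route_shorten i k p : is_route i k p ->
  exists2 q : steps G, is_dipath i k q &
    {subset route_vertices i q <= route_vertices i p}.
Proof.
elim: p i => [|[a v] p IHp] i.
  by move=> ikp; exists [::]; rewrite // /is_dipath ikp.
case/and3P=> ai av /IHp[q /andP[vkq uniq_q] sub_qp].
have [i_q|i_q] := boolP (i \in route_vertices v q).
  have [p1 [p2 [eq_q /andP[vip1 _] ikp2]]] := first_passage_split vkq i_q.
  rewrite eq_q (route_vertices_cat _ vip1) in uniq_q sub_qp.
  (* The path [q] from [v] returns to [i]: its tail from [i] on is already a path, so the first arc
     and [p1] are discarded. *)
  exists p2.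
    by move: uniq_q; rewrite cat_uniq /is_dipath ikp2 => /and3P[].
  by move=> x xp2; rewrite inE sub_qp ?orbT // mem_cat xp2 orbT.
exists ((a, v) :: q).
  by rewrite /is_dipath /= ai av vkq i_q.
by move=> x; rewrite inE => /predU1P[->|/sub_qp x_p];
  rewrite in_cons ?eqxx // x_p orbT.
Qed.

Definition first_passage_weight i j : \bar R :=
  (\esum_(p in [set p | first_passage i j p]) (route_weight p)%:E)%E.

Definition avoiding_routes i j k :=
  [set p : steps G | is_route i k p && (j \notin route_vertices i p)].

Definition avoiding_weight i j k : \bar R :=
  (\esum_(p in avoiding_routes i j k) (route_weight p)%:E)%E.

Lemma route_weight_ge0 p : (0 <= (route_weight p)%:E)%E.
Proof. by rewrite lee_fin ltW ?route_weight_gt0. Qed.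

Hint Resolve route_weight_ge0 : core.

Lemma routes_weight_ge0 i j : (0 <= routes_weight G i j)%E.
Proof. exact: esum_ge0. Qed.

Lemma routes_weight_id_ge1 j : (1 <= routes_weight G j j)%E.
Proof.
(* The route of length 0 alone contributes 1. *)
suff <- : (route_weight ([::] : steps G))%:E = 1%E.
  by apply: le_term_esum => /=.
by rewrite /route_weight big_nil.
Qed.

Lemma first_passage_weight_le i j :
  (first_passage_weight i j <= routes_weight G i j)%E.
Proof. by apply: le_esum_subset => // p /andP[]. Qed.

Lemma avoiding_weight_le i j k :
  (avoiding_weight i j k <= routes_weight G i k)%E.
Proof. by apply: le_esum_subset => // p /andP[]. Qed.

(** A path avoiding [j] is itself an avoiding route of positive weight; conversely, loop erasure
    turns any avoiding route into such a path. *)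
Lemma avoiding_weight_eq0 i j k :
  avoiding_weight i j k = 0%E <->
  forall p : steps G, is_dipath i k p -> j \in route_vertices i p.
Proof.
split=> [w0 p /andP[ikp _]|path_j].
  apply: contraT => j_p; have: (0 < avoiding_weight i j k)%E.
    apply: (@lt_le_trans _ _ (route_weight p)%:E).
      by rewrite lte_fin route_weight_gt0.
    by apply: le_term_esum => //; apply/andP.
  by rewrite w0 ltxx.
apply: esum1 => p /andP[/route_shorten[q ikq sub_qp]] /negP[].
exact/sub_qp/path_j.
Qed.

Lemma avoiding_weight_end i j : avoiding_weight i j j = 0%E.
Proof.
by apply/avoiding_weight_eq0 => p /andP[ijp _]; apply: route_end_mem.
Qed.

(** Concatenation is a weight-multiplicative bijection from pairs (first passage to [j], route from
    [j] to [k]) onto the routes through [j]. Finiteness lets the second factor be pulled out as a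
    real scalar. *)
Lemma routes_weight_split i j k : routes_weight G j k \is a fin_num ->
  routes_weight G i k =
  (first_passage_weight i j * routes_weight G j k + avoiding_weight i j k)%E.
Proof.
move=> fin_jk; rewrite {1}/routes_weight.
rewrite (esumID [set p | j \in route_vertices i p]) //; congr (_ + _)%E.
  rewrite (@reindex_esum _ _ _
    ([set p | first_passage i j p] `*`` fun=> [set q | is_route j k q]) _
    (fun pq => pq.1 ++ pq.2)); last first.
    (* Concatenation lands in the target set, is injective, and is surjective. *)
    split=> [[p q] /= [/andP[ijp _] jkq]|[p q] [p' q']|p [/= ikp j_p]].
    - split; first by rewrite (route_catE _ _ ijp).
      by rewrite (route_vertices_cat _ ijp) mem_cat mem_head orbT.
    - rewrite !inE /= => -[fp _] [fp' _] eq_cat.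
      have eq_p := first_passage_uniq fp fp' eq_cat; subst p'.
      by move/eqP: eq_cat; rewrite eqseq_cat // => /andP[_ /eqP->].
    by have [p1 [p2 [-> fp1 jkp2]]] := first_passage_split ikp j_p; exists (p1, p2).
  rewrite -(esum_esum (a := fun p q => (route_weight (p ++ q))%:E)) //.
  rewrite muleC -(fineK fin_jk) -ge0_esumZl ?fine_ge0 ?routes_weight_ge0 //.
  apply: eq_esum => p _; rewrite fineK // muleC.
  rewrite -ge0_esumZl ?ltW ?route_weight_gt0 //.
  by apply: eq_esum => q _; rewrite route_weight_cat EFinM.
congr esum; apply/seteqP; split=> p /=; last by case/andP=> -> /negP.
by case=> ikp /negP j_p; apply/andP.
Qed.

End FirstPassage.

Theorem theorem6 (R : realType) (n : nat) (G : wdmultigraph R n)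
    (routes_finite : forall i j : 'I_n, routes_weight G i j \is a fin_num) :
  transitional_measure G (routes_matrix G).
Proof.
have le_routes_fin i j (x : \bar R) :
    (0 <= x)%E -> (x <= routes_weight G i j)%E -> x \is a fin_num.
  move=> x_ge0 x_le; rewrite ge0_fin_numE // (le_lt_trans x_le) //.
  by rewrite -ge0_fin_numE ?routes_weight_ge0.
have f_fin i j : first_passage_weight G i j \is a fin_num.
  apply: le_routes_fin (first_passage_weight_le G i j).
  by apply: esum_ge0 => p _; apply: route_weight_ge0.
have b_ge0 i j k : (0 <= avoiding_weight G i j k)%E.
  by apply: esum_ge0 => p _; apply: route_weight_ge0.
have b_fin i j k : avoiding_weight G i j k \is a fin_num.
  exact: le_routes_fin (b_ge0 i j k) (avoiding_weight_le G i j k).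
have S_jj j : 0 < routes_matrix G j j.
  rewrite mxE (lt_le_trans ltr01) // -lee_fin fineK //.
  exact: routes_weight_id_ge1.
have S_split i j k : routes_matrix G i k =
    fine (first_passage_weight G i j) * routes_matrix G j k +
    fine (avoiding_weight G i j k).
  by rewrite !mxE {1}(routes_weight_split i (routes_finite j k)) fineD ?fineM
             ?fin_numM.
have S_gap i j k : routes_matrix G i k * routes_matrix G j j =
    routes_matrix G i j * routes_matrix G j k +
    fine (avoiding_weight G i j k) * routes_matrix G j j.
  rewrite (S_split i j k) (S_split i j j) avoiding_weight_end /=.
  by ring.
split=> i j k; rewrite S_gap.
  by rewrite lerDl mulr_ge0 ?fine_ge0 // ltW.
rewrite -avoiding_weight_eq0; split=> [eq_S|->]; last by rewrite mul0r addr0.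
(* As [fine] also sends infinity to 0, this passage to reals rests on [b_fin]; the positive factor
   [S_jj] then cancels. *)
apply/eqP; rewrite -fine_eq0 //; move/eqP: eq_S.
by rewrite addrC -subr_eq subrr eq_sym mulf_eq0 (gt_eqF (S_jj j)) orbF.
Qed.
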